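(* Let $v, w \in S_n$ be permutations and let $y_1,\dots,y_n$ be variables. Then $$\mathfrak{S}_w(y_{v(1)},\dots,y_{v(n)}\,;\,y_1,\dots,y_n) \;=\; \sum_{D} \prod_{(i,j)\in D}\left(y_{v(j)}-y_i\right),$$ where the sum is over all reduced FK-graphs $D$ for $w$ with respect to $\mathfrak{D}_v$, i.e. over all subsets $D\subset C(\mathfrak{D}_v)$ with $w(D)=w$ and $|D|=\ell(w)$.
   Context: $S_n$ is the symmetric group on $\{1,\dots,n\}$, $\ell$ is the length (number of inversions), products of permutations are compositions of maps ($(uv)(i)=u(v(i))$), and $s_i$ is the transposition of $i$ and $i+1$. Double Schubert polynomials (Lascoux–Schützenberger). For $w\in S_n$, $\mathfrak{S}_w(x;y)=\mathfrak{S}_w(x_1,\dots,x_n;y_1,\dots,y_n)$ is the polynomial with integer coefficients determined by: $\mathfrak{S}_{w_0}(x;y)=\prod_{i+j\le n}(x_i-y_j)$ for $w_0$ the longest element of $S_n$, and $\mathfrak{S}_{ws_i}=\partial_i(\mathfrak{S}_w)$ whenever $w(i)>w(i+1)$, where $\partial_i(f)=\dfrac{f-f'}{x_i-x_{i+1}}$ and $f'$ is obtained from $f$ by interchanging $x_i$ and $x_{i+1}$. Diagram. For $v\in S_n$, the diagram $\mathfrak{D}_v$ consists, in matrix coordinates (row, column), of the hooks of lines going due north and due west from the points $(v(j),j)$, $1\le j\le n$. Its set of crossing positions is $$C(\mathfrak{D}_v)=\{(i,j)\in\{1,\dots,n\}^2 : v(j)>i \text{ and } v^{-1}(i)>j\}.$$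 For $(i,j)\in C(\mathfrak{D}_v)$ set $\nu(i,j)=j+\#\{k>j : v(k)<i\}$. Degenerate Hecke algebra. $\mathcal{H}$ is the associative unital $\mathbb{Z}$-algebra generated by symbols $s_1,s_2,\dots$ modulo the relations $s_is_j=s_js_i$ if $|i-j|\ge 2$, $s_is_{i+1}s_i=s_{i+1}s_is_{i+1}$, and $s_i^2=-s_i$. It has a $\mathbb{Z}$-basis of permutations, where a permutation $u$ corresponds to the product $s_{i_1}\cdots s_{i_\ell}$ for any reduced expression of $u$. FK-graphs. For a subset $D\subset C(\mathfrak{D}_v)$, form the product in $\mathcal{H}$ of the generators $s_{\nu(i,j)}$ for $(i,j)\in D$, in south-west to north-east order: the factor $s_{\nu(i,j)}$ comes before (to the left of) the factor $s_{\nu(i',j')}$ whenever $i\ge i'$ and $j\le j'$ with $(i,j)\neq(i',j')$ (the product does not depend on the choice of linear order compatible with this). This product equals plus or minus a single permutation, denoted $w(D)$. One says that $D$ is an FK-graph (Fomin–Kirillov graph) for $w(D)$ with respect to $\mathfrak{D}_v$, and that $D$ is reduced if $|D|=\ell(w(D))$. *)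

(* Defs.v *)
From HB Require Import structures.
From mathcomp Require Import all_boot all_fingroup all_algebra.
From mathcomp Require Import boolp.
From mathcomp Require monalg.
From mathcomp Require Import mpoly.
From mathcomp Require Import zify ring.

Set Implicit Arguments.
Unset Strict Implicit.
Unset Printing Implicit Defensive.

Import GRing.Theory.
Local Open Scope ring_scope.

(* Everything is indexed from 0: the element i of {1, ..., n} is the ordinal
   i - 1 : 'I_n, and the generator s_k is the one of index k - 1. *)

(* Composition of maps, (u v)(i) = u (v i); the group law of 'S_n composes in
   the opposite order. *)
Definition pcomp n (u v : 'S_n) : 'S_n := (v * u)%g.

Lemma pcompE n (u v : 'S_n) i : pcomp u v i = u (v i).
Proof. by rewrite /pcomp permM. Qed.

Definition plength n (w : 'S_n) : nat :=
  #|[set p : 'I_n * 'I_n | (p.1 < p.2)%N && (w p.2 < w p.1)%N]|.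

(* ordS is the cyclic successor, so this is an adjacent transposition only when
   i.+1 < n; every use below is guarded by that condition. *)
Definition adjt n (i : 'I_n) : 'S_n := tperm i (ordS i).

Definition longest n : 'S_n := perm (@rev_ord_inj n).

(* Z[y][x]: the x_i are the variables, the y_j are the variables of the ring of
   coefficients. *)
Notation ypoly n := {mpoly int[n]}.
Notation xypoly n := {mpoly {mpoly int[n]}[n]}.

Section DividedDifference.
Variables (n : nat) (R : comNzRingType).
Implicit Types f g : {mpoly R[n]}.

Lemma divdiff_exists (i j : 'I_n) f :
  exists g, ('X_i - 'X_j) * g == f - msym (tperm i j) f.
Proof.
suff [g Hg] : exists g, ('X_i - 'X_j) * g = f - msym (tperm i j) f.
  by exists g; apply/eqP.
have HM f1 f2 : (exists g, ('X_i - 'X_j) * g = f1 - msym (tperm i j) f1) ->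
    (exists g, ('X_i - 'X_j) * g = f2 - msym (tperm i j) f2) ->
    exists g, ('X_i - 'X_j) * g = f1 * f2 - msym (tperm i j) (f1 * f2).
  move=> [g1 H1] [g2 H2]; exists (g1 * f2 + msym (tperm i j) f1 * g2).
  rewrite mulrDr mulrA H1 mulrCA H2 msymM; ring.
have HX k : exists g, ('X_i - 'X_j) * g = 'X_k - msym (tperm i j) 'X_k.
  have -> : msym (tperm i j) 'X_k = 'X_(tperm i j k) :> {mpoly R[n]}.
    rewrite msymX; congr 'X_[_]; apply/mnmP => l; rewrite !mnmE tpermV.
    by rewrite -(inj_eq (@perm_inj _ (tperm i j))) tpermK.
  by case: tpermP => [->|->|_ _]; [exists 1|exists (-1)|exists 0]; ring.
elim/mpolyind: f => [|c m p _ _ [g Hg]].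
  by exists 0; rewrite msym0 mulr0 subrr.
have [h Hh] : exists g, ('X_i - 'X_j) * g = 'X_[m] - msym (tperm i j) 'X_[m].
  rewrite (mpolyXE_id _ m).
  apply: (big_ind (fun p => exists g, ('X_i - 'X_j) * g = p - msym _ p)) => [|f1 f2|k _].
  - by exists 0; rewrite rmorph1 mulr0 subrr.
  - exact: HM.
  elim: (m k) => [|e IHe]; first by exists 0; rewrite expr0 rmorph1 mulr0 subrr.
  by rewrite exprS; apply: HM.
exists (c *: h + g); rewrite mulrDr -scalerAr Hh Hg msymD msymZ scalerBr; ring.
Qed.

Definition divdiff (i j : 'I_n) f : {mpoly R[n]} := xchoose (divdiff_exists i j f).

Lemma divdiffP (i j : 'I_n) f :
  ('X_i - 'X_j) * divdiff i j f = f - msym (tperm i j) f.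
Proof. exact/eqP/(xchooseP (divdiff_exists i j f)). Qed.

End DividedDifference.

Definition ddiff n (i : 'I_n) (f : xypoly n) : xypoly n := divdiff i (ordS i) f.

Definition dschub_top n : xypoly n :=
  \prod_(i < n) \prod_(j < n | ((i + j).+1 < n)%N) ('X_i - ('X_j)%:MP).

Definition asc n (w : 'S_n) (i : 'I_n) : bool :=
  (i.+1 < n)%N && (w i < w (ordS i))%N.

Definition noninv n (w : 'S_n) : {set 'I_n * 'I_n} :=
  [set p : 'I_n * 'I_n | (p.1 < p.2)%N && (w p.1 < w p.2)%N].

Fixpoint dschub_rec n (k : nat) (w : 'S_n) : xypoly n :=
  match k, [pick i | asc w i] with
  | k'.+1, Some i => ddiff i (dschub_rec k' (pcomp w (adjt i)))
  | _, _ => dschub_top n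
  end.

(* Climb from w to the longest element, one ascent at a time.  The result does
   not depend on the ascents chosen: lemmas dschub_longest and dschub_descent
   are the two conditions which determine the double Schubert polynomials. *)
Definition dschub n (w : 'S_n) : xypoly n := dschub_rec #|noninv w| w.

Lemma commute_ring (A : comNzRingType) (u v k l f sf tf stf tsf df dg sdg tdf : A) :
  stf = tsf -> u * k = dg - sdg -> v * l = df - tdf ->
  v * dg = f - tf -> v * sdg = sf - stf -> u * df = f - sf ->
  u * tdf = tf - tsf -> u * v * k = u * v * l.
Proof.
move=> e Hk Hl H1 H2 H3 H4.
by rewrite mulrAC Hk mulrC mulrBr H1 H2 -mulrA Hl mulrBr H3 H4 e; ring.
Qed.

Lemma braid_ring (A : comNzRingType)
    (u v w k h sh g sg tg stg f sf tf tsf stf stsf : A) :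
  v = u + w -> u * k = h - sh -> w * h = g - tg -> v * sh = sg - stg ->
  sg = g ->  u * g = f - sf -> v * tg = tf - tsf -> w * stg = stf - stsf ->
  u * w * v * k = f - sf - tf + tsf + stf - stsf.
Proof.
move=> ev Hk Hh Sh esg; rewrite {}esg in Sh; move=> Hg Tg Ug.
have -> : u * w * v * k = w * v * (u * k) by ring.
have -> : w * v * (u * k) = v * (w * h) - w * (v * sh) by rewrite Hk; ring.
have -> : v * (w * h) - w * (v * sh) = (v - w) * g - v * tg + w * stg.
  by rewrite Hh Sh; ring.
by rewrite Tg Ug {1}ev addrK Hg; ring.
Qed.

Lemma braid_eq (A : comNzRingType) (u w v k l f a b c d x y : A) :
  u * w * v * k = f - a - b + c + d - x ->
  w * u * v * l = f - b - a + d + c - y -> x = y -> u * w * v * k = u * w * v * l.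
Proof. by move=> -> + xy; rewrite -xy (mulrC w) => ->; ring. Qed.

Section DividedDifferenceTheory.
Variables (n : nat) (R : idomainType).
Implicit Types (f g : {mpoly R[n]}) (i j a b c d : 'I_n).

Lemma msym_var (s : 'S_n) i : msym s 'X_i = 'X_(s i) :> {mpoly R[n]}.
Proof.
rewrite msymX; congr 'X_[_]; apply/mnmP => l; rewrite !mnmE.
by rewrite -(inj_eq (@perm_inj _ s)) permKV.
Qed.

Lemma varB_neq0 i j : i != j -> 'X_i - 'X_j != 0 :> {mpoly R[n]}.
Proof.
move=> ij; rewrite subr_eq0; apply/negP => /eqP /(congr1 (mcoeff U_(i))).
rewrite !mcoeffXU eqxx eq_sym (negPf ij) /= => /eqP.
by rewrite oner_eq0.
Qed.

Lemma msym_divdiff i j f : i != j -> msym (tperm i j) (divdiff i j f) = divdiff i j f.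
Proof.
move=> ij; have H := divdiffP i j f.
apply: (mulfI (varB_neq0 ij)).
have := congr1 (msym (tperm i j)) H.
rewrite msymM !msymB !msym_var tpermL tpermR -msymMm tperm2 msym1m => H1.
rewrite H -[LHS]opprK -mulNr opprB H1; ring.
Qed.

Lemma msym_divdiffE a b a' b' (s : 'S_n) f : s a = a' -> s b = b' ->
  ('X_a' - 'X_b') * msym s (divdiff a b f) =
  msym s f - msym s (msym (tperm a b) f).
Proof. by move=> <- <-; rewrite -msymB -divdiffP msymM msymB !msym_var. Qed.

Lemma msym2_divdiffE a b a' b' (s t : 'S_n) f :
  t (s a) = a' -> t (s b) = b' ->
  ('X_a' - 'X_b') * msym t (msym s (divdiff a b f)) =
  msym t (msym s f) - msym t (msym s (msym (tperm a b) f)).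
Proof.
move=> <- <-; have /(congr1 (msym t)) := @msym_divdiffE a b _ _ s f erefl erefl.
by rewrite msymM !msymB !msym_var.
Qed.

Lemma divdiffC a b c d f :
  a != b -> c != d -> a != c -> a != d -> b != c -> b != d ->
  divdiff a b (divdiff c d f) = divdiff c d (divdiff a b f).
Proof.
move=> ab cd ac ad bc bd.
have Hcd := divdiffP c d f; have Hab := divdiffP a b f.
have Kcd := divdiffP c d (divdiff a b f).
have Kab := divdiffP a b (divdiff c d f).
have ca : c != a by rewrite eq_sym.
have da : d != a by rewrite eq_sym.
have cb : c != b by rewrite eq_sym.
have db : d != b by rewrite eq_sym.
have Scd := msym_divdiffE f (tpermD ac bc) (tpermD ad bd).
have Sab := msym_divdiffE f (tpermD ca da) (tpermD cb db).
apply: (mulfI (mulf_neq0 (varB_neq0 ab) (varB_neq0 cd))).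
apply: commute_ring Kab Kcd Hcd Scd Hab Sab; rewrite -!msymMm.
have -> // : (tperm a b * tperm c d = tperm c d * tperm a b)%g.
by rewrite conjgC tpermJ (tpermD ca da) (tpermD cb db).
Qed.

Lemma divdiff_braid a b c f : a != b -> b != c -> a != c ->
  divdiff a b (divdiff b c (divdiff a b f)) =
  divdiff b c (divdiff a b (divdiff b c f)).
Proof.
move=> ab bc ac.
have ca : c != a by rewrite eq_sym.
have ba : b != a by rewrite eq_sym.
have E1 := @tpermR _ a b; have E2 := tpermD ac bc.
have E3 := tpermD ba ca; have E4 := @tpermL _ b c.
have F1 : tperm a b (tperm b c a) = b by rewrite E3 tpermL.
have F2 : tperm a b (tperm b c b) = c by rewrite E4 E2.
have G1 : tperm b c (tperm a b b) = a by rewrite E1 E3.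
have G2 : tperm b c (tperm a b c) = b by rewrite E2 tpermR.
have ev : 'X_a - 'X_c = ('X_a - 'X_b) + ('X_b - 'X_c) :> {mpoly R[n]}.
  by rewrite addrA subrK.
have ev' : 'X_a - 'X_c = ('X_b - 'X_c) + ('X_a - 'X_b) :> {mpoly R[n]}.
  by rewrite ev addrC.
have K1 := braid_ring ev (divdiffP a b _) (divdiffP b c _) (msym_divdiffE _ E1 E2)
  (msym_divdiff f ab) (divdiffP a b f) (msym_divdiffE f E3 E4)
  (msym2_divdiffE f F1 F2).
have K2 := braid_ring ev' (divdiffP b c _) (divdiffP a b _) (msym_divdiffE _ E3 E4)
  (msym_divdiff f bc) (divdiffP b c f) (msym_divdiffE f E1 E2)
  (msym2_divdiffE f G1 G2).
apply: (mulfI (mulf_neq0 (mulf_neq0 (varB_neq0 ab) (varB_neq0 bc)) (varB_neq0 ac))).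
apply: braid_eq K1 K2 _; rewrite -!msymMm.
have H : (tperm a b * tperm b c * tperm a b = tperm a c)%g.
  by rewrite -{1}(tpermV a b) -mulgA -conjgE tpermJ tpermR (tpermD ac bc).
have H' : (tperm b c * tperm a b * tperm b c = tperm a c)%g.
  by rewrite -{1}(tpermV b c) -mulgA -conjgE tpermJ tpermL (tpermD ba ca).
by rewrite !mulgA H H'.
Qed.

End DividedDifferenceTheory.

Section DoubleSchubert.
Variable n : nat.
Implicit Types (w : 'S_n) (i j : 'I_n).

Lemma ordS_val i : (i.+1 < n)%N -> ordS i = i.+1 :> nat.
Proof. by move=> h; rewrite /= modn_small. Qed.

Lemma adjtK w i : pcomp (pcomp w (adjt i)) (adjt i) = w.
Proof. by rewrite /pcomp mulgA tperm2 mul1g. Qed.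

Lemma card_noninv_asc w i : asc w i ->
  #|noninv w| = #|noninv (pcomp w (adjt i))|.+1.
Proof.
case/andP=> hi wi; have Si := ordS_val hi.
have niS : i != ordS i by rewrite -val_eqE /= modn_small // neq_ltn leqnn.
have in_i : (i, ordS i) \in noninv w by rewrite inE /= modn_small // leqnn.
rewrite (cardsD1 (i, ordS i)) in_i add1n; congr _.+1.
pose f (p : 'I_n * 'I_n) := (adjt i p.1, adjt i p.2).
have fK : involutive f by case=> a b; rewrite /f /= !tpermK.
rewrite -(card_imset _ (inv_inj fK)); apply: eq_card => p.
have -> : (p \in [set f x | x in noninv w :\ (i, ordS i)]) =
    (f p \in noninv w :\ (i, ordS i)).
  apply/imsetP/idP => [[q qA ->]|fp]; first by rewrite fK.
  by exists (f p); rewrite ?fK.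
case: p => a b; rewrite !inE /f /= !pcompE xpair_eqE -!val_eqE /=.
have Sm := modn_small hi; rewrite Sm /adjt.
case: (tpermP i (ordS i) a) => [->|->|/eqP + /eqP]; rewrite -?val_eqE /= ?Sm;
case: (tpermP i (ordS i) b) => [->|->|/eqP + /eqP]; rewrite -?val_eqE /= ?Sm; lia.
Qed.

Lemma asc_far w i j : i != j -> ordS i != j -> i != ordS j -> asc w i ->
  asc (pcomp w (adjt j)) i.
Proof.
move=> ij Sij iSj /andP[hi wi]; apply/andP; split => //.
by rewrite !pcompE /adjt !tpermD // 1?eq_sym // (inj_eq (@ordS_inj n)).
Qed.

Lemma adjt_far w i j : i != j -> ordS i != j -> i != ordS j ->
  pcomp (pcomp w (adjt i)) (adjt j) = pcomp (pcomp w (adjt j)) (adjt i).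
Proof.
move=> ij Sij iSj; rewrite /pcomp !mulgA; congr (_ * _)%g.
have SiSj : ordS i != ordS j by rewrite (inj_eq (@ordS_inj n)).
by rewrite conjgC tpermJ !tpermD // eq_sym.
Qed.

Lemma adjt_braid w i : i != ordS i -> ordS i != ordS (ordS i) ->
    i != ordS (ordS i) ->
  pcomp (pcomp (pcomp w (adjt i)) (adjt (ordS i))) (adjt i) =
  pcomp (pcomp (pcomp w (adjt (ordS i))) (adjt i)) (adjt (ordS i)).
Proof.
move=> ab bc ac; rewrite /pcomp /adjt !mulgA; congr (_ * _)%g.
set b := ordS i in ab bc ac *; set c := ordS b in ab bc ac *.
have -> : (tperm i b * tperm b c * tperm i b = tperm i c)%g.
  by rewrite -{1}(tpermV i b) -mulgA -conjgE tpermJ tpermR (tpermD ac bc).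
have ca : c != i by rewrite eq_sym.
have ba : b != i by rewrite eq_sym.
by rewrite -{1}(tpermV b c) -mulgA -conjgE tpermJ tpermL (tpermD ba ca).
Qed.

Lemma dschub_asc w i : asc w i -> dschub w = ddiff i (dschub (pcomp w (adjt i))).
Proof.
suff IH N : forall w i, (#|noninv w| < N)%N -> asc w i ->
    dschub w = ddiff i (dschub (pcomp w (adjt i))) by exact: IH (leqnn _).
elim: N => // N IHN {}w {}i leN ai.
rewrite {1}/dschub (card_noninv_asc ai) /=.
case: pickP => [j aj|/(_ i)]; last by rewrite ai.
have := card_noninv_asc ai; rewrite (card_noninv_asc aj) => -[<-].
rewrite -/(dschub _).
have step (u : 'S_n) k : (#|noninv u| < #|noninv w|)%N -> asc u k ->
    dschub u = ddiff k (dschub (pcomp u (adjt k))).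
  by move=> lt_uw au; apply: IHN => //; apply: leq_trans lt_uw _; rewrite -ltnS.
have lti k (u : 'S_n) : asc u k -> (#|noninv (pcomp u (adjt k))| < #|noninv u|)%N.
  by move=> /card_noninv_asc->.
have [->//|nij] := eqVneq i j.
have braid a b : asc w a -> asc w b -> ordS a = b ->
    ddiff a (dschub (pcomp w (adjt a))) = ddiff b (dschub (pcomp w (adjt b))).
  move=> aa ab eab; have [ha wab] := andP aa; have [hb wbc] := andP ab.
  have eb : b = a.+1 :> nat by rewrite -eab ordS_val.
  have ec : ordS b = a.+2 :> nat by rewrite ordS_val // eb.
  rewrite eab in wab; set c := ordS b in wbc ec.
  have nab : a != b by rewrite -val_eqE /= eb; lia.
  have nbc : b != c by rewrite -val_eqE [val c]ec /= eb; lia.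
  have nac : a != c by rewrite -val_eqE [val c]ec /=; lia.
  have nba : b != a by rewrite eq_sym.
  have nca : c != a by rewrite eq_sym.
  have ta : adjt a = tperm a b by rewrite /adjt eab.
  have tb : adjt b = tperm b c by [].
  have a1 : asc (pcomp w (adjt a)) b.
    rewrite /asc hb !pcompE -/c ta tpermR (tpermD nac nbc).
    exact: ltn_trans wab wbc.
  have a2 : asc (pcomp (pcomp w (adjt a)) (adjt b)) a.
    by rewrite /asc ha !pcompE eab ta tb tpermL (tpermD nba nca) tpermL (tpermD nac nbc).
  have b1 : asc (pcomp w (adjt b)) a.
    rewrite /asc ha !pcompE eab tb tpermL (tpermD nba nca).
    exact: ltn_trans wab wbc.
  have b2 : asc (pcomp (pcomp w (adjt b)) (adjt a)) b.
    by rewrite /asc hb !pcompE -/c ta tb tpermR (tpermD nac nbc) (tpermD nba nca) tpermR.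
  rewrite (step _ b (lti _ _ aa) a1) (step _ a (ltn_trans (lti _ _ a1) (lti _ _ aa)) a2).
  rewrite (step _ a (lti _ _ ab) b1) (step _ b (ltn_trans (lti _ _ b1) (lti _ _ ab)) b2).
  have <- : pcomp (pcomp (pcomp w (adjt a)) (adjt b)) (adjt a) =
       pcomp (pcomp (pcomp w (adjt b)) (adjt a)) (adjt b).
    by rewrite -eab; apply: adjt_braid; rewrite eab.
  by rewrite /ddiff eab -/c; apply: divdiff_braid.
have [eji|nji] := eqVneq (ordS i) j; first by rewrite (braid i j).
have [eij|nij'] := eqVneq (ordS j) i; first by rewrite (braid j i).
have nji' : j != i by rewrite eq_sym.
have n1 : i != ordS j by rewrite eq_sym.
have n2 : j != ordS i by rewrite eq_sym.
have aij : asc (pcomp w (adjt i)) j by apply: asc_far.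
have aji : asc (pcomp w (adjt j)) i by apply: asc_far.
rewrite (step _ i (lti _ _ aj) aji) (step _ j (lti _ _ ai) aij).
rewrite (adjt_far w nij nji n1).
have [hi _] := andP ai; have [hj _] := andP aj.
apply: divdiffC => //.
- by rewrite -val_eqE [val (ordS j)]ordS_val //=; lia.
- by rewrite -val_eqE [val (ordS i)]ordS_val //=; lia.
- by rewrite (inj_eq (@ordS_inj n)).
Qed.

Lemma dschub_longest : dschub (longest n) = dschub_top n.
Proof.
rewrite /dschub; suff -> : #|noninv (longest n)| = 0%N by [].
apply/eqP; rewrite cards_eq0; apply/eqP/setP => p; rewrite !inE !permE /=.
by apply/negP; have := ltn_ord p.1; have := ltn_ord p.2; lia.
Qed.

Lemma dschub_descent w i : (i.+1 < n)%N -> (w (ordS i) < w i)%N ->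
  dschub (pcomp w (adjt i)) = ddiff i (dschub w).
Proof.
move=> hi wi; rewrite (@dschub_asc _ i) ?adjtK //.
by rewrite /asc hi !pcompE /adjt tpermL tpermR.
Qed.

End DoubleSchubert.

(* Positions are (row, column). *)
Definition crossings n (v : 'S_n) : {set 'I_n * 'I_n} :=
  [set p : 'I_n * 'I_n | (p.1 < v p.2)%N && (p.2 < (v^-1)%g p.1)%N].

Definition nu n (v : 'S_n) (p : 'I_n * 'I_n) : nat :=
  (p.2 + #|[set k : 'I_n | (p.2 < k)%N && (v k < p.1)%N]|)%N.

(* monalg is imported only inside this module: its notations for polynomials
   clash with those of mpoly. *)
Module DegenerateHecke.
Import monalg.

Definition free_alg := {malg int[{fmonom nat}]}.

Definition gen (k : nat) : free_alg := << fmu k >>.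

(* The two-sided ideal generated by the defining relations. *)
Inductive ideal : free_alg -> Prop :=
| ideal_comm i j of (i.+1 < j)%N || (j.+1 < i)%N :
    ideal (gen i * gen j - gen j * gen i)
| ideal_braid i :
    ideal (gen i * gen i.+1 * gen i - gen i.+1 * gen i * gen i.+1)
| ideal_square i : ideal (gen i * gen i - (- gen i))
| ideal_add a b of ideal a & ideal b : ideal (a + b)
| ideal_mul a b c of ideal b : ideal (a * b * c).

(* Equality, in the quotient of the free algebra by the ideal, of the classes
   of a and b. *)
Definition eqH (a b : free_alg) : Prop := ideal (a - b).

Definition word (r : seq nat) : free_alg := \prod_(k <- r) gen k.

(* Product of generators in south-west to north-east order: the rows are read
   from bottom to top, each of them from left to right. *)
Definition swne n (D : {set 'I_n * 'I_n}) : seq ('I_n * 'I_n) :=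
  [seq p <- [seq (i, j) | i <- rev (enum 'I_n), j <- enum 'I_n] | p \in D].

Definition FK_product n (v : 'S_n) (D : {set 'I_n * 'I_n}) : free_alg :=
  word [seq nu v p | p <- swne D].

Definition reduced_expr n (w : 'S_n) (r : seq 'I_n) : Prop :=
  [/\ all (fun i : 'I_n => i.+1 < n)%N r,
      foldr (fun i u => pcomp (adjt i) u) 1%g r = w & size r = plength w].

(* w(D) = w: the product is plus or minus the basis element w. *)
Definition is_FK_perm n (v : 'S_n) (D : {set 'I_n * 'I_n}) (w : 'S_n) : Prop :=
  exists r : seq 'I_n, reduced_expr w r /\
  exists e : bool,
    eqH (FK_product v D) ((-1) ^+ e * word [seq val i | i <- r]).

End DegenerateHecke.

Definition FK_graph n (v : 'S_n) (D : {set 'I_n * 'I_n}) (w : 'S_n) : Prop :=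
  D \subset crossings v /\ DegenerateHecke.is_FK_perm v D w.

Definition reduced_FK_graph n (v : 'S_n) (D : {set 'I_n * 'I_n}) (w : 'S_n) : Prop :=
  FK_graph v D w /\ #|D| = plength w.

(* Main.v *)
Require Import Defs.
From mathcomp Require Import all_boot all_fingroup all_algebra.
From mathcomp Require Import boolp mpoly.
From mathcomp Require Import zify ring.

(* Write S_w|_v for S_w(y_{v(1)}, ..., y_{v(n)}; y).  Evaluating
   (x_i - x_{i+1}) d_i(S_w) = S_w - s_i S_w at x = y_v gives
     S_w|_{v s_i} = S_w|_v + (y_{v(i+1)} - y_{v(i)}) S_{w s_i}|_v,
   where the last term is present only if w(i) > w(i+1).  Moreover S_w|_1 = 0
   for w <> 1, by descending induction on l(w) from S_{w0}.  Hence any word for v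
   expresses S_w|_v as S_1|_1 times a sum over those subwords which are reduced
   words for w.  The crossings of the diagram of v, read from south-west to
   north-east, spell such a word, and the transposition read at (i, j) exchanges
   the values i and v(j), which produces the weights y_{v(j)} - y_i.  The case
   v = w = w0, where both sides are the same nonzero product, shows S_1|_1 = 1.
   Finally, H acts on Z[S_n] with s_k sending u to -u s_k if this is longer than
   u, and to -u otherwise; following the image of 1 under this action, a word of
   length l(w) represents plus or minus w in H only if it is a reduced word for
   w. *)

Local Open Scope ring_scope.
Set Implicit Arguments.
Unset Strict Implicit.
Unset Printing Implicit Defensive.
Import GRing.Theory.

(* ssrfun.pcomp would take precedence otherwise. *)
Local Notation pcomp := Defs.pcomp.

(** * Length and reduced words *)

Section Length.
Variable n : nat.
Implicit Types (u v w : 'S_n) (i j k : 'I_n).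

Definition des w i : bool := (i.+1 < n)%N && (w (ordS i) < w i)%N.

Lemma ordS_neq i : (i.+1 < n)%N -> i != ordS i.
Proof. by move=> h; rewrite -val_eqE [val (ordS i)]ordS_val // ltn_eqF. Qed.

Lemma asc_adjt w i : asc (pcomp w (adjt i)) i = des w i.
Proof. by rewrite /asc /des !pcompE /adjt tpermL tpermR. Qed.

Lemma des_adjt w i : des (pcomp w (adjt i)) i = asc w i.
Proof. by rewrite -asc_adjt adjtK. Qed.

Lemma desNasc w i : (i.+1 < n)%N -> des w i = ~~ asc w i.
Proof.
move=> h; rewrite /des /asc h /= -leqNgt ltn_neqAle.
by rewrite (inj_eq (@ord_inj n)) (inj_eq perm_inj) eq_sym (ordS_neq h).
Qed.

(** Turns [card_noninv_asc], which counts non-inversions, into statements about length. *)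
Lemma plength_noninv w :
  (plength w + #|noninv w| = #|[set p : 'I_n * 'I_n | p.1 < p.2]|)%N.
Proof.
rewrite -(cardsID [set p : 'I_n * 'I_n | w p.2 < w p.1]%N); congr (_ + _)%N.
  by apply: eq_card => p; rewrite !inE.
apply: eq_card => p; rewrite !inE -leqNgt [(w p.1 < _)%N]ltn_neqAle andbC.
rewrite (inj_eq (@ord_inj n)) (inj_eq perm_inj).
by have [lt_p|] := ltnP p.1 p.2; rewrite ?andbF //= -val_eqE (ltn_eqF lt_p).
Qed.

Lemma plength_asc w i : asc w i -> plength (pcomp w (adjt i)) = (plength w).+1.
Proof.
move=> /card_noninv_asc e; have := plength_noninv w.
by have := plength_noninv (pcomp w (adjt i)); rewrite e; lia.
Qed.

Lemma plength_des w i : des w i -> plength w = (plength (pcomp w (adjt i))).+1.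
Proof. by rewrite -asc_adjt => /plength_asc <-; rewrite adjtK. Qed.

Lemma plength_adjt_le w i : (i.+1 < n)%N ->
  (plength (pcomp w (adjt i)) <= (plength w).+1)%N.
Proof.
move=> h; have [/plength_asc -> //|] := boolP (asc w i).
by rewrite -desNasc // => /plength_des ->; rewrite leqW.
Qed.

Lemma plength1 : plength (1 : 'S_n)%g = 0%N.
Proof.
apply/eqP; rewrite cards_eq0; apply/eqP/setP => p; rewrite !inE !perm1.
by apply/negP => /andP[]; lia.
Qed.

Lemma perm_le_eq1 u : (forall i, u i <= i)%N -> u = 1%g.
Proof.
move=> le_u; apply/permP => i; rewrite perm1; move: {2}(val i) (leqnn i) => m.
elim: m i => [|m IH] i /= im; apply/ord_inj; have := le_u i; first by lia.
rewrite leq_eqVlt => /orP[/eqP //|lt_ui]; have /perm_inj e := IH (u i) ltac:(lia).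
by rewrite e ltnn in lt_ui.
Qed.

Lemma longest_le u : (forall i, longest n i <= u i)%N -> u = longest n.
Proof.
move=> H; have: (u * longest n = 1)%g.
  by apply: perm_le_eq1 => i; have := H i; rewrite permM !permE /=; lia.
move/(congr1 (mulg^~ (longest n))); rewrite -mulgA mul1g.
suff -> : (longest n * longest n = 1)%g by rewrite mulg1.
by apply/permP => i; rewrite permM !permE rev_ordK.
Qed.

(** Without ascents [w] is strictly decreasing, so going back from the last position its values
    dominate those of [longest n]. *)
Lemma noasc_longest w : (forall i, ~~ asc w i) -> w = longest n.
Proof.
move=> Hw; apply: longest_le => i; rewrite permE /=.
move: {2}(n - i)%N (leqnn (n - i)%N) => m.
elim: m i => [|m IH] i im; first by lia.
have [h|] := ltnP i.+1 n; last by lia.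
have := Hw i; rewrite -desNasc // /des h /= => lt_w.
have := IH (ordS i); rewrite [nat_of_ord (ordS i)]ordS_val // => /(_ ltac:(lia)); lia.
Qed.

End Length.

Section Words.
Variable n : nat.
Implicit Types (u v w : 'S_n) (i j k : 'I_n) (r : seq 'I_n).

(* [revred r w] holds when the reversal of r is a reduced word for w. *)
Fixpoint revred r w : bool :=
  if r is i :: r' then des w i && revred r' (pcomp w (adjt i)) else w == 1%g.

Definition wprod r : 'S_n := foldr (fun i u => pcomp (adjt i) u) 1%g r.

Lemma wprod_rcons r i : wprod (rcons r i) = pcomp (wprod r) (adjt i).
Proof.
rewrite /wprod; elim: r => [|j r IH] /=; first by rewrite /pcomp mul1g mulg1.
by rewrite IH /pcomp mulgA.
Qed.

Lemma plength_wprod r : all (fun i => i.+1 < n)%N r -> (plength (wprod r) <= size r)%N.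
Proof.
elim/last_ind: r => [|r i IH]; first by rewrite plength1.
rewrite all_rcons wprod_rcons size_rcons => /andP[h /IH le_r].
by apply: leq_trans (plength_adjt_le _ h) _.
Qed.

(** If the last letter [i] were a descent of the product of [r], the full product would be shorter
    than [r], hence shorter than its own word. So [i] is an ascent there, and a descent of [w]. *)
Lemma revredP r w : DegenerateHecke.reduced_expr w r <-> revred (rev r) w.
Proof.
rewrite /DegenerateHecke.reduced_expr -/(wprod r).
elim/last_ind: r w => [|r i IH] w.
  split=> [[_ <- _] //|/eqP->]; first exact: eqxx.
  by split=> //; rewrite plength1.
rewrite rev_rcons /= all_rcons size_rcons wprod_rcons; split.
  case=> /andP[h ar] <- e.
  have w' : pcomp (pcomp (wprod r) (adjt i)) (adjt i) = wprod r by rewrite adjtK.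
  have ai : asc (wprod r) i.
    apply: contraT; rewrite -desNasc // => /plength_des.
    by have := plength_wprod ar; rewrite -e; lia.
  rewrite des_adjt ai w'; apply/IH; split=> //.
  by move: e; rewrite (plength_asc ai) => -[].
move=> /andP[di /IH [ar e sz]]; split.
- by rewrite ar andbT; case/andP: di.
- by rewrite e adjtK.
by rewrite (plength_des di) sz.
Qed.

(* The identity for k >= n - 1: the generators out of range also need to act,
   compatibly with the braid relations. *)
Definition dstep u (k : nat) : 'S_n :=
  if insub k is Some i then if asc u i then pcomp u (adjt i) else u else u.

Lemma dstepE u i : dstep u i = if asc u i then pcomp u (adjt i) else u.
Proof. by rewrite /dstep valK. Qed.

Lemma plength_dstep u (k : nat) : (plength (dstep u k) <= (plength u).+1)%N.
Proof.
rewrite /dstep; case: insubP => [i _ _|_]; last exact: leqnSn.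
by case: ifP => [/plength_asc ->|_].
Qed.

Lemma plength_dword u (m : seq nat) : (plength (foldl dstep u m) <= size m + plength u)%N.
Proof.
elim: m u => //= k m IH u; apply: leq_trans (IH _) _.
by rewrite addSnnS leq_add2l plength_dstep.
Qed.

(** A step raises the length by at most one, so a word whose size is the length of its endpoint must
    climb at every letter; [dstep] is then ordinary multiplication throughout. *)
Lemma dword_revred r w :
  revred (rev r) w <->
  foldl dstep 1%g (map val r) = w /\ size r = plength w.
Proof.
elim/last_ind: r w => [|r i IH] w.
  split=> [/eqP -> //|[<- _]]; [by rewrite plength1|exact: eqxx].
rewrite rev_rcons /= map_rcons foldl_rcons dstepE size_rcons.
split=> [/andP[di /IH [-> sz]]|].
  by rewrite asc_adjt di adjtK (plength_des di) sz.
have := plength_dword 1%g (map val r); rewrite plength1 addn0 size_map.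
case: ifP => [ai le_r [<-]|_ le_r [<- sz]]; last by exfalso; move: le_r; rewrite -sz ltnn.
by rewrite des_adjt ai adjtK (plength_asc ai) => -[sz]; apply/IH.
Qed.

Lemma dstep_out u (k : nat) : (n <= k.+1)%N -> dstep u k = u.
Proof.
by move=> h; rewrite /dstep; case: insubP => // i _ ei; rewrite /asc ei ltnNge h.
Qed.

Lemma dstep_idem u (k : nat) : dstep (dstep u k) k = dstep u k.
Proof.
rewrite {2 3}/dstep; case: insubP => [i _ <-|h]; last by rewrite /dstep insubN.
rewrite dstepE; case: (boolP (asc u i)) => [ai|/negPf -> //].
by rewrite asc_adjt desNasc ?ai //; case/andP: ai.
Qed.

Lemma dstepC u (a b : nat) : (a.+1 < b)%N || (b.+1 < a)%N ->
  dstep (dstep u a) b = dstep (dstep u b) a.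
Proof.
move=> ab; have [ha|ha] := ltnP a.+1 n; last by rewrite !(dstep_out _ ha).
have [hb|hb] := ltnP b.+1 n; last by rewrite !(dstep_out _ hb).
pose i := Ordinal (ltnW ha); pose j := Ordinal (ltnW hb).
have [h h'] : (i.+1 < n)%N /\ (j.+1 < n)%N by [].
rewrite -[a]/(val i) -[b]/(val j) !dstepE.
have Si := ordS_val h; have Sj := ordS_val h'.
have [n1 n2 n3] : [/\ i != j, ordS i != j & i != ordS j].
  rewrite -!val_eqE [val (ordS i)]Si [val (ordS j)]Sj /=.
  by move: ab => /=; split; apply/eqP; lia.
have far (x y : 'I_n) : x != y -> ordS x != y -> x != ordS y ->
    asc (pcomp u (adjt y)) x = asc u x.
  move=> e1 e2 e3; rewrite /asc !pcompE /adjt !tpermD // 1?eq_sym //.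
  by rewrite (inj_eq (@ordS_inj n)).
have fi := far i j n1 n2 n3.
have fj : asc (pcomp u (adjt i)) j = asc u j by apply: far; rewrite eq_sym.
by case ai: (asc u i); case aj: (asc u j); rewrite ?fi ?fj ?ai ?aj // adjt_far.
Qed.

(** Both sides sort the values of [u] at positions [a], [a.+1], [a.+2] into decreasing order. *)
Lemma dstep_braid u (a : nat) :
  dstep (dstep (dstep u a) a.+1) a = dstep (dstep (dstep u a.+1) a) a.+1.
Proof.
have [h|h] := ltnP a.+2 n; last first.
  (* Here [a.+1] acts as the identity, and both sides reduce to [dstep u a]. *)
  by rewrite !(dstep_out _ h) dstep_idem.
have [i ei] : {i : 'I_n | val i = a} by exists (Ordinal (ltnW (ltnW h))).
have h1 : (i.+1 < n)%N by rewrite [nat_of_ord i]ei; lia.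
have eb : val (ordS i) = a.+1 by rewrite [val _]ordS_val // -ei.
set b := ordS i in eb; have h2 : (b.+1 < n)%N by rewrite [nat_of_ord b]eb.
have ec : val (ordS b) = a.+2 by rewrite [val _]ordS_val // -eb.
set c := ordS b in ec.
have nab : i != b by rewrite -val_eqE ei eb; lia.
have nbc : b != c by rewrite -val_eqE eb ec; lia.
have nac : i != c by rewrite -val_eqE ei ec; lia.
have nba : b != i by rewrite eq_sym.
have nca : c != i by rewrite eq_sym.
rewrite -eb -ei !dstepE.
have ascE (x : 'S_n) : asc x i = (x i < x b)%N by rewrite /asc h1.
have ascE' (x : 'S_n) : asc x b = (x b < x c)%N by rewrite /asc h2.
have Pi x y : pcomp x (adjt i) y = x (tperm i b y) by rewrite pcompE.
have Pb x y : pcomp x (adjt b) y = x (tperm b c y) by rewrite pcompE.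
have Ti := (tpermL i b, tpermR i b, tpermD nac nbc, tpermL b c, tpermR b c, tpermD nba nca).
have br := adjt_braid u nab nbc nac.
have ltNge x y : x != y -> (u x < u y)%N = ~~ (u y < u x)%N.
  move=> xy; rewrite -leqNgt ltn_neqAle.
  by rewrite (inj_eq (@ord_inj n)) (inj_eq perm_inj) xy.
have ncb : c != b by rewrite eq_sym.
have [[F1 F2] F3] := (ltNge _ _ nba, ltNge _ _ ncb, ltNge _ _ nca).
(* Of the eight outcomes of the three comparisons, two contradict transitivity; the others are the
   six relative orders. *)
case E1: (u i < u b)%N F1 => /= F1; case E2: (u b < u c)%N F2 => /= F2;
case E3: (u i < u c)%N F3 => /= F3.
all: try by exfalso; lia.
all: by do 3! rewrite ?(ascE, ascE', Pi, Pb, Ti, E1, E2, E3, F1, F2, F3) //=.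
Qed.

End Words.

(** * An action of the degenerate Hecke algebra *)

Module HeckeFunctional.
Import monalg DegenerateHecke.
Section Functional.
Variable n : nat.
Implicit Types (u : 'S_n) (g : 'S_n -> int) (a b : free_alg) (m : {fmonom nat}).

(* The linear form e_x |-> g x, evaluated at the image of e_u under a, for the
   right action of the free algebra on Z[S_n] in which s_k sends e_x to
   - e_(dstep x k). *)
Definition functional u g a : int :=
  mmap idfun (fun m => (-1) ^+ size m * g (foldl (@dstep n) u m)) a.

Lemma functionalU u g c m :
  functional u g << c *g m >> = c * ((-1) ^+ size m * g (foldl (@dstep n) u m)).
Proof. exact: mmapU. Qed.

Lemma functionalB u g a b : functional u g (a - b) = functional u g a - functional u g b.
Proof. exact: raddfB. Qed.

Lemma functionalN u g a : functional u g (- a) = - functional u g a.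
Proof. exact: raddfN. Qed.

Lemma functional_sum u g (T : Type) (r : seq T) (F : T -> free_alg) :
  functional u g (\sum_(i <- r) F i) = \sum_(i <- r) functional u g (F i).
Proof. exact: raddf_sum. Qed.

Lemma functionalMl u g c m a :
  functional u g (<< c *g m >> * a) =
  c * (-1) ^+ size m * functional (foldl (@dstep n) u m) g a.
Proof.
rewrite [in LHS](monalgE a) mulr_sumr functional_sum /functional mmapE mulr_sumr.
apply: eq_bigr => k _; rewrite malgM_def fgmulUU mmapU /= fmM size_cat exprD foldl_cat.
ring.
Qed.

Lemma functionalMr u g c m a :
  functional u g (a * << c *g m >>) =
  functional u (fun x => c * (-1) ^+ size m * g (foldl (@dstep n) x m)) a.
Proof.
rewrite [in LHS](monalgE a) mulr_suml functional_sum [RHS]mmapE.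
apply: eq_bigr => k _; rewrite malgM_def fgmulUU functionalU /= fmM size_cat exprD foldl_cat.
ring.
Qed.

Lemma functional_word u g (r : seq nat) :
  functional u g (word r) = (-1) ^+ size r * g (foldl (@dstep n) u r).
Proof.
rewrite /word; elim: r u => [|k r IH] u.
  by rewrite big_nil functionalU fm1 mul1r.
by rewrite big_cons functionalMl fmU IH /= expr1 exprS mul1r mulrA.
Qed.

(** A left monomial factor only moves the starting point [u], and a right one only changes the form
    [g]. Hence the induction quantifies over both. *)
Lemma functional_ideal u g a : ideal a -> functional u g a = 0.
Proof.
move=> Ia; elim: Ia u g => {a} [i j ij|i|i|a b _ IHa _ IHb|a b c _ IH] u g.
- have e x y : gen x * gen y = word [:: x; y] by rewrite /word !big_cons big_nil mulr1.
  by rewrite functionalB !e !functional_word /= dstepC // subrr.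
- have e x y z : gen x * gen y * gen z = word [:: x; y; z].
    by rewrite /word !big_cons big_nil mulr1 mulrA.
  by rewrite functionalB !e !functional_word /= dstep_braid subrr.
- have -> : gen i * gen i = word [:: i; i] by rewrite /word !big_cons big_nil mulr1.
  have -> : gen i = word [:: i] by rewrite /word big_cons big_nil mulr1.
  rewrite functionalB functionalN !functional_word /= dstep_idem.
  by rewrite sqrrN !expr1n mul1r mulN1r opprK subrr.
- by rewrite -[b]opprK functionalB functionalN IHa IHb oppr0 subr0.
rewrite [in LHS](monalgE c) mulr_sumr functional_sum big1 // => k _.
rewrite functionalMr [in LHS](monalgE a) mulr_suml functional_sum big1 // => k' _.
by rewrite functionalMl IH mulr0.
Qed.

End Functional.

Lemma eqH_refl a : eqH a a.
(* Zero belongs to the ideal as a relation multiplied by 0 on both sides. *)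
Proof. by have := ideal_mul 0 0 (ideal_square 0); rewrite !mul0r /eqH subrr. Qed.

(** Test the congruence against the indicator of the endpoint [x] of [r]: if [r'] ended elsewhere,
    only a sign would remain, and it would have to be 0. *)
Lemma eqH_dword n (r r' : seq nat) (e : bool) :
  eqH (word r) ((-1) ^+ e * word r') ->
  foldl (@dstep n) 1%g r = foldl (@dstep n) 1%g r'.
Proof.
set x := foldl _ _ r; move=> Ia.
have := functional_ideal (1%g : 'S_n) (fun y => (y == x)%:R) Ia.
have -> : (-1) ^+ e * word r' = (<< (-1) ^+ e *g mone >> : free_alg) * word r'.
  by case: e Ia => _; rewrite ?expr0 ?expr1 // monalgUN.
rewrite functionalB functionalMl fm1 !functional_word -/x eqxx mulr1 eq_sym.
case: eqP => // _; rewrite !mulr0 subr0 => /eqP.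
by rewrite signr_eq0.
Qed.

End HeckeFunctional.

(** * Localizations of double Schubert polynomials *)

Lemma meval_msym n (R : comNzRingType) (s : 'S_n) (h : 'I_n -> R) (p : {mpoly R[n]}) :
  (msym s p).@[h] = p.@[fun i => h (s i)].
Proof.
elim/mpolyind: p => [|c m p _ _ IH]; first by rewrite msym0 !meval0.
rewrite msymD msymZ !mevalD !mevalZ IH; congr (_ * _ + _).
rewrite msymX !mevalX (reindex_inj (@perm_inj _ s)) /=.
by apply: eq_bigr => i _; rewrite mnmE permK.
Qed.

Section Localization.
Variable n : nat.
Implicit Types (u v w : 'S_n) (i j : 'I_n).

Definition loc w v : ypoly n := (dschub w).@[fun i => 'X_(v i)].

(** At an ascent [dschub w] lies in the image of a divided difference, hence is symmetric in the two
    variables. *)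
Lemma msym_dschub_asc w i : asc w i -> msym (adjt i) (dschub w) = dschub w.
Proof.
move=> ai; rewrite (dschub_asc ai); apply: msym_divdiff.
by apply: ordS_neq; case/andP: ai.
Qed.

Lemma loc_msym w v i :
  (msym (adjt i) (dschub w)).@[fun k => 'X_(v k) : ypoly n] = loc w (pcomp v (adjt i)).
Proof. by rewrite meval_msym; apply: meval_eq => k; rewrite pcompE. Qed.

Lemma loc_adjt w v i : (i.+1 < n)%N ->
  loc w (pcomp v (adjt i)) = loc w v +
    (if des w i then ('X_(v (ordS i)) - 'X_(v i)) * loc (pcomp w (adjt i)) v else 0).
Proof.
move=> hi; case: (boolP (des w i)) => [/andP[_ di]|]; last first.
  by rewrite desNasc // negbK => ai; rewrite -loc_msym msym_dschub_asc ?addr0.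
rewrite -loc_msym /loc dschub_descent //.
have := congr1 (fun p => p.@[fun k => 'X_(v k) : ypoly n]) (divdiffP i (ordS i) (dschub w)).
rewrite mevalM !mevalB !mevalXU -/(adjt i) => e.
by rewrite -opprB mulNr e opprB addrC subrK.
Qed.

Lemma loc_longest v : loc (longest n) v =
  \prod_(i < n) \prod_(j < n | ((i + j).+1 < n)%N) ('X_(v i) - 'X_j).
Proof.
rewrite /loc dschub_longest /dschub_top rmorph_prod; apply: eq_bigr => i _ /=.
rewrite rmorph_prod; apply: eq_bigr => j _ /=.
by rewrite mevalB mevalXU mevalC.
Qed.

(** Some [v i] lies below [longest n i], so the factor indexed by [(i, v i)] occurs in the product,
    and it vanishes. *)
Lemma loc_longest_eq0 v : v != longest n -> loc (longest n) v = 0.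
Proof.
move=> nv; have [i lt_i] : exists i, (v i < longest n i)%N.
  apply/existsP; apply: contraNT nv; rewrite negb_exists => /forallP H.
  by apply/eqP/longest_le => i; rewrite leqNgt.
rewrite loc_longest (bigD1 i) //= (bigD1 (v i)) /= ?subrr ?mul0r //.
by move: lt_i; rewrite permE /=; lia.
Qed.

(** Only [v = 1] is needed later, but the induction must cover [v] and [v s_i] together: if
    [w' = w s_i] is longer than [w], both localizations of [w'] vanish, and [loc_adjt] leaves a
    nonzero difference of variables times [loc w v]. *)
Lemma loc_eq0 w v : (plength v <= plength w)%N -> v != w -> loc w v = 0.
Proof.
move: {2}#|noninv w| (leqnn #|noninv w|) => m.
elim: m w v => [|m IH] w v le_m le_vw vw; case: (pickP (asc w)) => [i ai|Hw].
- by have := card_noninv_asc ai; lia.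
- by rewrite (@noasc_longest _ w) ?loc_longest_eq0 -?(@noasc_longest _ w) // => i; rewrite Hw.
- set w' := pcomp w (adjt i); have [hi _] := andP ai.
  have le_w' : (#|noninv w'| <= m)%N by have := card_noninv_asc ai; rewrite -/w'; lia.
  have sz : plength w' = (plength w).+1 by apply: plength_asc.
  have w'v : loc w' v = 0.
    apply: IH; rewrite ?sz ?leqW //; apply: contraTneq le_vw => ->.
    by rewrite sz ltnn.
  have w'v' : loc w' (pcomp v (adjt i)) = 0.
    apply: IH; rewrite ?sz //; first exact: leq_trans (plength_adjt_le v hi) _.
    by apply: contraNneq vw => e; rewrite -(adjtK v i) e adjtK.
  have := loc_adjt w' v hi; rewrite des_adjt ai adjtK w'v w'v' add0r.
  move/esym/eqP; rewrite mulf_eq0 (negPf (varB_neq0 _ _)) => [/eqP //|].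
  by rewrite (inj_eq perm_inj) eq_sym ordS_neq.
by rewrite (@noasc_longest _ w) ?loc_longest_eq0 -?(@noasc_longest _ w) // => i; rewrite Hw.
Qed.

Lemma loc_longest_neq0 : loc (longest n) (longest n) != 0.
Proof.
rewrite loc_longest; apply/prodf_neq0 => i _; apply/prodf_neq0 => j ij.
by apply: varB_neq0; rewrite -val_eqE permE /=; lia.
Qed.

(** * Sums over reduced subwords *)

Section Chain.
Variables (v : 'S_n) (a : 'I_n * 'I_n -> 'I_n).
Implicit Types (p : 'I_n * 'I_n) (l : seq ('I_n * 'I_n)).

(* The reversal of l spells a word for u whose successive letters exchange the
   values p.1 and v p.2, for p in l. *)
Inductive chain : seq ('I_n * 'I_n) -> 'S_n -> Prop :=
| chain_nil : chain [::] 1%g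
| chain_cons p l u of ((a p).+1 < n)%N & u (a p) = p.1 & u (ordS (a p)) = v p.2
    & chain l u : chain (p :: l) (pcomp u (adjt (a p))).

Lemma chain_sum l u w : chain l u -> uniq l ->
  loc w u = loc 1%g 1%g *
    \sum_(D : {set 'I_n * 'I_n} |
          (D \subset l) && revred [seq a p | p <- l & p \in D] w)
       \prod_(p in D) ('X_(v p.2) - 'X_(p.1)).
Proof.
move=> C; elim: C w => {l u} [|p l u hp up uSp _ IH] w.
  move=> _; have [->|w1] := eqVneq w 1%g.
    rewrite (big_pred1 set0) ?big_set0 ?mulr1 // => D /=.
    rewrite eqxx andbT; apply/subsetP/eqP => [D0|-> q]; last by rewrite inE.
    by apply/setP => q; rewrite inE; apply/negP => /D0.
  rewrite loc_eq0 1?eq_sym // ?plength1 //.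
  by rewrite big1 ?mulr0 // => D /andP[_] /=; rewrite (negPf w1).
case/andP=> pl ul; rewrite loc_adjt // up uSp (bigID (fun D : {set _} => p \in D)) /=.
rewrite mulrDr addrC; congr (_ + _).
  (* Subsets containing [p] give the correction term of [loc_adjt]: the letter [a p] is used, so it
     must be a descent of [w]. Subsets avoiding [p] give the term [loc w u]. *)
  rewrite (reindex_onto (fun D => p |: D) (fun D => D :\ p)) /=; last first.
    by move=> D /andP[_ pD]; rewrite setD1K.
  have e (D : {set 'I_n * 'I_n}) :
     [&& p |: D \subset p :: l,
       revred [seq a q | q <- if p \in p |: D then p :: [seq q <- l | q \in p |: D]
                              else [seq q <- l | q \in p |: D]] w,
       p \in p |: D & (p |: D) :\ p == D] =
     des w (a p) && ((D \subset l) && revred [seq a q | q <- l & q \in D] (pcomp w (adjt (a p)))).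
    rewrite setU11 /=.
    have -> : [seq q <- l | q \in p |: D] = [seq q <- l | q \in D].
      by apply: eq_in_filter => q ql; rewrite !inE; case: eqP ql pl => // -> ->.
    case: (des w (a p)) => /=; last by rewrite !andbF.
    rewrite andbA andbAC; congr (_ && _).
    apply/andP/subsetP => [[/subsetP sD /eqP eD] q qD|sD].
      have := sD q; rewrite !inE qD orbT => /(_ isT) /orP[/eqP qp|//].
      by move: qD; rewrite -eD qp !inE eqxx.
    have pD : p \notin D by apply: contra pl => /sD.
    split; last by rewrite setU1K.
    apply/subsetP => q; rewrite !inE => /orP[->//|/sD ->]; exact: orbT.
  under eq_bigl => D do rewrite -!andbA e.
  case: ifP => _; last by rewrite big_pred0_eq mulr0.
  rewrite IH // mulrCA; congr (_ * _); rewrite mulr_sumr; apply: eq_bigr => D /andP[/subsetP sD _].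
  by rewrite big_setU1 //; apply: contra pl => /sD.
rewrite IH //; congr (_ * _); apply: eq_bigl => D.
case: (boolP (p \in D)) => pD; rewrite ?andbF ?andbT.
  by apply/negbTE/negP => /andP[/subsetP/(_ p pD)]; rewrite (negPf pl).
congr (_ && _); apply/subsetP/subsetP => sD q qD.
  by rewrite inE sD ?orbT.
by have := sD q qD; rewrite inE; case: eqP pD qD => // -> /negPf ->.
Qed.

End Chain.
End Localization.

(** * The reading word of the diagram *)

Section ReadingWord.
Variables (n : nat) (v : 'S_n).
Implicit Types (i j k : 'I_n) (p : 'I_n * 'I_n) (D : {set 'I_n * 'I_n}).

Let s : seq nat := [seq val (v k) | k <- enum 'I_n].

(** The default [p.1] is never taken at a crossing, by [nu_lt]. *)
Definition nu_ord p : 'I_n := insubd p.1 (nu v p).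

Lemma size_oneline : size s = n.
Proof. by rewrite size_map size_enum_ord. Qed.

Lemma perm_oneline : perm_eq s (iota 0 n).
Proof.
rewrite -val_enum_ord /s (map_comp val v); apply: perm_map.
apply: uniq_perm => [||k]; rewrite ?(map_inj_uniq (@perm_inj _ v)) ?enum_uniq //.
by rewrite mem_enum; apply/mapP; exists ((v^-1)%g k); rewrite ?mem_enum ?permKV.
Qed.

Lemma nth_oneline k : nth 0%N s k = v k.
Proof. by rewrite (nth_map k) ?size_enum_ord // nth_ord_enum. Qed.

Lemma drop_oneline k : drop k s = (v k : nat) :: drop k.+1 s.
Proof. by rewrite (drop_nth 0%N) ?size_oneline // nth_oneline. Qed.

Lemma take_oneline k : take k.+1 s = rcons (take k s) (v k : nat).
Proof. by rewrite (take_nth 0%N) ?size_oneline // nth_oneline. Qed.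

Lemma oneline_cut i : s = take ((v^-1)%g i) s ++ (i : nat) :: drop ((v^-1)%g i).+1 s.
Proof. by rewrite -[LHS](cat_take_drop ((v^-1)%g i)) drop_oneline permKV. Qed.

Lemma oneline_notin i :
  (nat_of_ord i \notin take ((v^-1)%g i) s) && (nat_of_ord i \notin drop ((v^-1)%g i).+1 s).
Proof.
have: uniq s by rewrite (perm_uniq perm_oneline) iota_uniq.
by rewrite {1}(oneline_cut i) uniq_catC /= mem_cat negb_or andbC => /andP[_ /andP[-> ->]].
Qed.

Lemma notin_take i j : (j <= (v^-1)%g i)%N -> nat_of_ord i \notin take j s.
Proof.
move=> le_j; rewrite -(take_takel _ le_j); have /andP[+ _] := oneline_notin i.
by apply: contra => /mem_take.
Qed.

Lemma count_oneline_lt i : count (fun x => x < i)%N s = i.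
Proof.
rewrite (seq.permP perm_oneline).
have -> : iota 0 n = iota 0 i ++ iota i (n - i) by rewrite -iotaD subnKC // ltnW.
rewrite count_cat (eq_in_count (a2 := predT)) => [|x]; last first.
  by rewrite mem_iota add0n => /andP[_ ->].
rewrite count_predT size_iota (eq_in_count (a2 := pred0)) ?count_pred0 ?addn0 // => x.
by rewrite mem_iota => /andP[le_i _] /=; rewrite ltnNge le_i.
Qed.

Lemma card_after j (P : pred nat) :
  #|[set k : 'I_n | (j < k)%N && P (v k)]| = count P (drop j.+1 s).
Proof.
rewrite cardE /enum_mem size_filter -enumT -(cat_take_drop j.+1 (enum 'I_n)) count_cat.
have mem_val (t : seq 'I_n) k : k \in t -> val k \in map val t by apply: map_f.
rewrite (eq_in_count (a2 := pred0)) ?count_pred0 ?add0n => [|k /mem_val]; last first.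
  rewrite map_take val_enum_ord take_iota mem_iota => h.
  by rewrite !inE; case: (ltnP j k) => //; move: h => /=; lia.
rewrite /s -map_drop count_map; apply: eq_in_count => k /mem_val.
rewrite map_drop val_enum_ord drop_iota mem_iota => /andP[le_k _].
by rewrite /= !inE le_k.
Qed.

(** Count the [i] values below [i], before and after column [j], and the [j] entries before column
    [j], none of which is [i]. The result is the position of [i] in [state i j]. *)
Lemma nuE i j : (i, j) \in crossings v ->
  nu v (i, j) = (i + count (fun x => i < x) (take j s))%N.
Proof.
rewrite inE /= => /andP[lt_i lt_j]; rewrite /nu /= (card_after j (fun x => x < i)%N).
have ei : (count (fun x => x < i) (take j s) + count (fun x => x < i) (drop j.+1 s) = i)%N.
  rewrite -[RHS](count_oneline_lt i) -[in RHS](cat_take_drop j s) count_cat drop_oneline /=.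
  by rewrite ltnNge (ltnW lt_i).
have ej : (count (fun x => x < i) (take j s) + count (fun x => i < x) (take j s) = j)%N.
  have sz : size (take j s) = j by rewrite size_take size_oneline ltn_ord.
  rewrite -[RHS]sz -(count_predC (fun x => x < i)%N); congr (_ + _)%N.
  apply: eq_in_count => x xs /=; rewrite -leqNgt ltn_neqAle.
  by case: eqP xs (notin_take (ltnW lt_j)) => // -> ->.
by move: ei ej; lia.
Qed.

(* The one-line notation of the permutation reached once the rows below i and
   the first j cells of row i have been read: i is moved past the larger values
   among the first j entries of v. *)
Definition state (i j : nat) : seq nat :=
  iota 0 i ++ [seq x <- take j s | i < x]%N ++ i :: [seq x <- drop j s | i < x]%N.

Lemma state_start i : state i 0 = iota 0 i.+1 ++ [seq x <- s | i < x]%N.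
Proof. by rewrite /state take0 drop0 -addn1 iotaD /= -catA. Qed.

(** The value [i] has now reached its place among the larger values; this is the form in which
    [state_start] opens the row above. *)
Lemma state_end i : state i ((v^-1)%g i) = iota 0 i ++ [seq x <- s | i <= x]%N.
Proof.
have /andP[n1 n2] := oneline_notin i.
rewrite [in RHS](oneline_cut i) filter_cat /= leqnn /state drop_oneline permKV /= ltnn.
congr (_ ++ (_ ++ _ :: _)); apply: eq_in_filter => x xs; rewrite ltn_neqAle;
  case: eqP => // ex; move: n1 n2; rewrite ex xs //.
Qed.

Lemma size_state i (j : nat) : size (state i j) = n.
Proof.
have e (k : nat) : size (state i k) = (i + (count (fun x => i < x)%N s).+1)%N.
  rewrite /state !size_cat /= size_iota !size_filter addnS -count_cat.
  by rewrite cat_take_drop.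
rewrite e -(e ((v^-1)%g i)) state_end size_cat size_iota size_filter.
rewrite -{1}(count_oneline_lt i) -[RHS]size_oneline -(count_predC (fun x => x < i)%N s).
by congr (_ + _)%N; apply: eq_count => x /=; rewrite leqNgt.
Qed.

Lemma state_noncross i j : (v j < i)%N -> state i j.+1 = state i j.
Proof.
move=> lt_v; rewrite /state take_oneline drop_oneline filter_rcons /=.
by rewrite ltnNge (ltnW lt_v).
Qed.

Lemma state_cross i j : (i, j) \in crossings v ->
  exists A B, [/\ size A = nu v (i, j), state i j = A ++ (i : nat) :: (v j : nat) :: B &
    state i j.+1 = A ++ (v j : nat) :: (i : nat) :: B].
Proof.
move=> Cij; exists (iota 0 i ++ [seq x <- take j s | i < x]%N).
exists [seq x <- drop j.+1 s | i < x]%N; rewrite nuE // size_cat size_iota size_filter.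
have lt_i : (i < v j)%N by move: Cij; rewrite inE => /andP[].
by rewrite /state take_oneline drop_oneline filter_rcons /= lt_i -!catA cat_rcons.
Qed.

Lemma nu_lt i j : (i, j) \in crossings v -> ((nu v (i, j)).+1 < n)%N.
Proof.
move=> /state_cross [A [B [<- e _]]]; have := size_state i j.
by rewrite e size_cat /=; lia.
Qed.

Lemma val_nu_ord p : p \in crossings v -> val (nu_ord p) = nu v p.
Proof. by case: p => i j /nu_lt h; rewrite val_insubd ltnW. Qed.

Lemma nth_swap (T : Type) (x0 x y : T) (A B : seq T) (k : nat) :
  nth x0 (A ++ y :: x :: B) k =
  nth x0 (A ++ x :: y :: B)
    (if k == size A then k.+1 else if k == (size A).+1 then k.-1 else k).
Proof.
rewrite !nth_cat; have [->|nk] := eqVneq k (size A).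
  by rewrite ltnn subnn ltnNge leqnSn subSnn.
have [->|nk'] := eqVneq k (size A).+1; first by rewrite ltnn subnn ltnNge leqnSn subSnn.
case: ltnP => // le_k; case e : (k - size A)%N => [|[|m]] //; lia.
Qed.

Lemma chain_state i j l u : (i, j) \in crossings v -> chain v nu_ord l u ->
  (forall k, u k = nth 0%N (state i j) k :> nat) ->
  exists u', chain v nu_ord ((i, j) :: l) u' /\
    forall k, u' k = nth 0%N (state i j.+1) k :> nat.
Proof.
move=> Cij Cl st_u; have [A [B [sA e e']]] := state_cross Cij.
set a := nu_ord (i, j); have ea : a = size A :> nat by rewrite sA -val_nu_ord.
have ha : (a.+1 < n)%N by rewrite ea sA nu_lt.
exists (pcomp u (adjt a)); split.
  apply: chain_cons => //=; apply: ord_inj; rewrite st_u e nth_cat.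
    by rewrite ea ltnn subnn.
  by rewrite [nat_of_ord (ordS a)]ordS_val // ea ltnNge leqnSn subSnn.
move=> k; rewrite pcompE st_u e' nth_swap -e; congr nth.
rewrite -ea; case: tpermP => [->|->|/eqP + /eqP]; rewrite ?eqxx ?[nat_of_ord (ordS a)]ordS_val //.
  by rewrite eqn_leq ltnn /= eqxx.
by rewrite -!val_eqE /= [(a.+1 %% n)%N]modn_small // => /negPf -> /negPf ->.
Qed.

Definition row_cells i (t : seq 'I_n) := rev [seq (i, j) | j <- t].

(** From column [(v^-1) i] on, row [i] has no crossings and the state stops changing, hence the
    [minn]. *)
Lemma chain_row i l u (m : nat) : (m <= n)%N -> chain v nu_ord l u ->
  (forall k, u k = nth 0%N (state i 0) k :> nat) ->
  exists u', chain v nu_ord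
     ([seq p <- row_cells i (take m (enum 'I_n)) | p \in crossings v] ++ l) u' /\
    forall k, u' k = nth 0%N (state i (minn m ((v^-1)%g i))) k :> nat.
Proof.
move=> + Cl st_u; elim: m => [|m IH] le_m; first by exists u; rewrite take0 min0n.
have [u' [Cu' st_u']] := IH (ltnW le_m); pose j := Ordinal le_m.
have -> : take m.+1 (enum 'I_n) = rcons (take m (enum 'I_n)) j.
  by rewrite (take_nth j) ?size_enum_ord // (nth_ord_enum j j).
rewrite /row_cells map_rcons rev_rcons /= -/(row_cells _ _).
have [ge_m|lt_m] := leqP ((v^-1)%g i) m.
  rewrite inE /= [(m < _)%N]ltnNge ge_m andbF; exists u'; split => // k.
  by rewrite st_u' (minn_idPr ge_m) (minn_idPr (leqW ge_m)).
rewrite (minn_idPl (ltnW lt_m)) in st_u'; rewrite (minn_idPl lt_m).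
case: (boolP ((i, j) \in crossings v)) => [Cij|].
  exact: (chain_state (i := i) (j := j) Cij Cu' st_u').
(* Left of that column a non-crossing has [v j <= i], and equality would put [j] at the column
   itself. *)
rewrite inE /= lt_m andbT -leqNgt leq_eqVlt => /orP[/eqP /ord_inj e|lt_v].
  by move: lt_m; rewrite -e permK ltnn.
by exists u'; split => // k; rewrite st_u' -[m]/(val j) state_noncross.
Qed.

Lemma chain_rows (m : nat) : (m <= n)%N -> exists u, chain v nu_ord
    [seq p <- flatten [seq row_cells i (enum 'I_n) | i <- drop m (enum 'I_n)]
       | p \in crossings v] u /\
  forall k, u k = nth 0%N (iota 0 m ++ [seq x <- s | m <= x]%N) k :> nat.
Proof.
(* Rows are added from the bottom, so [m] becomes the number of rows already read; with none read
   the state is the identity. *)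
move=> le_m; rewrite -(subKn le_m); move: (n - m)%N (leq_subr m n) => {le_m}m le_m.
elim: m le_m => [|m IH] le_m.
  exists 1%g; rewrite subn0 drop_oversize ?size_enum_ord //; split; first exact: chain_nil.
  by move=> k; rewrite perm1 nth_cat size_iota ltn_ord nth_iota.
have [u [Cu st_u]] := IH (ltnW le_m); have lt_i : (n - m.+1 < n)%N by lia.
pose i := Ordinal lt_i; have ei : (n - m = i.+1)%N by rewrite /=; lia.
rewrite ei in Cu st_u; rewrite -[(n - m.+1)%N]/(val i).
have st0 k : u k = nth 0%N (state i 0) k :> nat by rewrite state_start st_u.
have [u' []] := chain_row (leqnn n) Cu st0.
have -> : minn n ((v^-1)%g i) = (v^-1)%g i by apply/minn_idPr/ltnW.
rewrite take_oversize ?size_enum_ord // state_end => Cu' st_u'.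
exists u'; split=> //; rewrite (drop_nth i) ?size_enum_ord // nth_ord_enum /=.
by rewrite filter_cat.
Qed.

Lemma chain_crossings :
  chain v nu_ord (rev (DegenerateHecke.swne (crossings v))) v.
Proof.
have [u [Cu st_u]] := chain_rows (leq0n n).
have e : u = v.
  by apply/permP => k; apply: ord_inj; rewrite st_u filter_predT nth_oneline.
rewrite e drop0 in Cu; rewrite -filter_rev rev_flatten -map_comp -map_rev revK.
exact: Cu.
Qed.

Lemma swne_uniq D : uniq (DegenerateHecke.swne D).
Proof.
apply/filter_uniq/allpairs_uniq; rewrite ?rev_uniq ?enum_uniq //.
by move=> [? ?] [? ?].
Qed.

Lemma mem_swne D : DegenerateHecke.swne D =i D.
Proof.
move=> [i j]; rewrite mem_filter andb_idr // => _.
by apply/allpairsP; exists (i, j); rewrite mem_rev !mem_enum.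
Qed.

Lemma size_swne D : size (DegenerateHecke.swne D) = #|D|.
Proof. by rewrite -(card_uniqP (swne_uniq D)); apply: eq_card; apply: mem_swne. Qed.

Lemma swne_sub D D' : D \subset D' ->
  [seq p <- DegenerateHecke.swne D' | p \in D] = DegenerateHecke.swne D.
Proof.
move=> /subsetP sD; rewrite /DegenerateHecke.swne -filter_predI; apply: eq_filter => p /=.
by rewrite andb_idr // => /sD.
Qed.

(** A word congruent to plus or minus a reduced expression of [w] has the same endpoint [w] under
    [dstep]; as its size is the length of [w], it is reduced. Conversely a reduced reading word
    serves as its own reduced expression, with sign plus. *)
Lemma reduced_FK_graphP D w :
  reduced_FK_graph v D w <->
  D \subset crossings v /\ revred [seq nu_ord p | p <- rev (DegenerateHecke.swne D)] w.
Proof.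
have nuD : D \subset crossings v -> [seq nu v p | p <- DegenerateHecke.swne D] =
    map val [seq nu_ord p | p <- DegenerateHecke.swne D].
  move/subsetP=> sD; rewrite -map_comp; apply/eq_in_map => p.
  by rewrite mem_swne => /sD /val_nu_ord.
rewrite map_rev; split.
  case=> [[sD [r [red_r [e /HeckeFunctional.eqH_dword H]]]] szD]; split=> //.
  apply/dword_revred; rewrite size_map size_swne; split=> //.
  by rewrite -nuD // H; apply: (proj1 (dword_revred r w) _).1; apply/revredP.
case=> sD red_D; have [_ szD] := (dword_revred _ _).1 red_D.
rewrite size_map size_swne in szD; split=> //; split=> //.
exists [seq nu_ord p | p <- DegenerateHecke.swne D]; split; first exact/revredP.
exists false; rewrite expr0 mul1r /DegenerateHecke.FK_product nuD //.
exact: HeckeFunctional.eqH_refl.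
Qed.

(** A crossing [(i, j)] is the inversion of [v] at positions [j] and [(v^-1) i]. *)
Lemma card_crossings : #|crossings v| = plength v.
Proof.
pose f p := (p.2, (v^-1)%g p.1).
have inj_f : injective f by move=> [i j] [i' j'] [-> /perm_inj ->].
rewrite -(card_imset _ inj_f); apply: eq_card => -[a b].
rewrite inE /=; apply/imsetP/andP => [[[i j] + [-> ->]]|[lt_ab lt_v]].
  by rewrite inE permKV => /andP[].
by exists (v b, a); rewrite /f ?inE /= permK ?lt_ab ?lt_v.
Qed.

Lemma loc_sum w : loc w v = loc 1%g 1%g *
  \sum_(D : {set 'I_n * 'I_n} | `[< reduced_FK_graph v D w >])
     \prod_(p in D) ('X_(v p.2) - 'X_(p.1)).
Proof.
rewrite (chain_sum _ chain_crossings) ?rev_uniq ?swne_uniq //; congr (_ * _).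
apply: eq_bigl => D; have -> : (D \subset rev (DegenerateHecke.swne (crossings v))) =
    (D \subset crossings v).
  by apply: eq_subset_r => p; rewrite mem_rev mem_swne.
apply/andP/asboolP => [[sD H]|/reduced_FK_graphP [sD H]].
  by apply/reduced_FK_graphP; split; rewrite // -(swne_sub sD) -filter_rev.
by split; rewrite // filter_rev swne_sub.
Qed.

End ReadingWord.

(** * Normalization at the longest element *)

Lemma loc_longest_crossings n : loc (longest n) (longest n) =
  \prod_(p in crossings (longest n)) ('X_(longest n p.2) - 'X_(p.1)).
Proof.
rewrite loc_longest pair_big_dep /=.
have inj_swap : injective (fun p : 'I_n * 'I_n => (p.2, p.1)) by move=> [? ?] [? ?] [-> ->].
rewrite (reindex_inj inj_swap) /=; apply: eq_bigl => -[i j]; rewrite inE /=.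
have -> : (longest n)^-1%g i = longest n i.
  by apply: (@perm_inj _ (longest n)); rewrite permKV !permE rev_ordK.
by rewrite !permE /=; have := ltn_ord i; have := ltn_ord j; lia.
Qed.

Lemma loc11 n : loc (1%g : 'S_n) 1%g = 1.
Proof.
set w0 := longest n; set C := crossings w0.
have uniqD (D : {set 'I_n * 'I_n}) : reduced_FK_graph w0 D w0 -> D = C.
  case=> [[sD _] szD]; apply/eqP; rewrite eqEcard sD.
  by rewrite szD -card_crossings leqnn.
have := loc_sum w0 w0; have := loc_longest_neq0 n; rewrite -/w0.
(* By cardinality only [C] can index a term. If it did not, the sum would be empty, against [nz]; so
   [C] is a reduced FK-graph without any computation of its word. *)
case: (pselect (reduced_FK_graph w0 C w0)) => [HC nz|HC nz]; last first.
  rewrite big1 ?mulr0 => [e|D /asboolP HD]; first by rewrite e eqxx in nz.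
  by case: HC; rewrite -(uniqD _ HD).
rewrite (big_pred1 C) => [|D]; last first.
  by apply/asboolP/eqP => [|->]; first exact: uniqD.
rewrite -loc_longest_crossings -/w0 => /esym/eqP.
by rewrite -subr_eq0 -{2}[loc w0 w0]mul1r -mulrBl mulf_eq0 (negPf nz) orbF subr_eq0 => /eqP.
Qed.

Theorem corollary1 (n : nat) (v w : 'S_n) :
  (dschub w).@[fun i : 'I_n => 'X_(v i) : ypoly n] =
  \sum_(D : {set 'I_n * 'I_n} | `[< reduced_FK_graph v D w >])
     \prod_(p in D) ('X_(v p.2) - 'X_(p.1) : ypoly n).
Proof. by rewrite -/(loc w v) loc_sum loc11 mul1r. Qed.
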